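(* Assume that there exist $\omega<0$ and a positive constant $C$ such that $$\|\nabla G(t,s)f\|_\infty\le Ce^{\omega(t-s)}\|f\|_\infty$$ for all $s\in I$, all $t\ge s+1$ and all $f\in C_b(\mathbb{R}^d)$. Assume further that $\{G(t,s)\}$ admits an evolution system of measures $(\mu_t)_{t\in I}$ such that, for some $p>0$, $$\lim_{t\to+\infty}\mu_t(p)\,e^{\omega pt}=0,\qquad\text{where }\mu_t(p):=\int_{\mathbb{R}^d}|x|^p\,\mu_t(dx).$$ Then $$\lim_{t\to+\infty}(G(t,s)f)(x)=\int_{\mathbb{R}^d}f(y)\,\mu_s(dy),\qquad x\in\mathbb{R}^d,$$ for all $s\in I$ and $f\in C_b(\mathbb{R}^d)$. If $I=\mathbb{R}$, then also, for all $t\in\mathbb{R}$ and $f\in C_b(\mathbb{R}^d)$, $$\lim_{s\to-\infty}\left((G(t,s)f)(x)-\int_{\mathbb{R}^d}f(y)\,\mu_s(dy)\right)=0,\qquad x\in\mathbb{R}^d.$$ In both cases the convergence is uniform for $x$ in compact sets of $\mathbb{R}^d$.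
   Context: $d\ge 1$ is an integer and $I\subset\mathbb{R}$ is an interval which is either $\mathbb{R}$ or a right halfline. For $t\in I$ and smooth $\varphi:\mathbb{R}^d\to\mathbb{R}$, $$(\mathcal{A}(t)\varphi)(x)=\sum_{i,j=1}^d q_{ij}(t,x)D_{ij}\varphi(x)+\sum_{i=1}^d b_i(t,x)D_i\varphi(x),$$ with $Q=(q_{ij})$, $b=(b_i)$. Standing assumptions: (1) for some $\alpha\in(0,1)$, all $q_{ij},b_i$ belong to $C^{\alpha/2,\alpha}_{\rm loc}(I\times\mathbb{R}^d)$, i.e. they are $\alpha$-Hölder continuous with respect to the parabolic distance on every compact subset of $I\times\mathbb{R}^d$; (2) for every $(t,x)\in I\times\mathbb{R}^d$ the matrix $Q(t,x)$ is symmetric, and there is a function $\eta:I\times\mathbb{R}^d\to\mathbb{R}$ with $0<\eta_0:=\inf_{I\times\mathbb{R}^d}\eta$ and $\langle Q(t,x)\xi,\xi\rangle\ge\eta(t,x)|\xi|^2$ for all $\xi\in\mathbb{R}^d$, $(t,x)\in I\times\mathbb{R}^d$; (3) for every bounded interval $J\subset I$ there exist $\varphi=\varphi_J\in C^2(\mathbb{R}^d)$ and $\lambda=\lambda_J>0$ such that $\lim_{|x|\to+\infty}\varphi(x)=+\infty$ and $(\mathcal{A}(t)\varphi)(x)-\lambda\varphi(x)\le0$ for $(t,x)\in J\times\mathbb{R}^d$. Under (1)-(3), for every $s\in I$ and $f\in C_b(\mathbb{R}^d)$ (bounded continuous functions, sup-norm $\|\cdot\|_\infty$) there is a unique bounded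 classical solution $u_f\in C_b([s,+\infty)\times\mathbb{R}^d)\cap C^{1,2}((s,+\infty)\times\mathbb{R}^d)$ of $u_t=\mathcal{A}(t)u$ in $(s,+\infty)\times\mathbb{R}^d$, $u(s,\cdot)=f$; for $t>s$, $(G(t,s)f)(x)=u_f(t,x)$, and $G(t,t)=\mathrm{id}$. There are unique Borel probability measures $p_{t,s}(x,\cdot)$ with $(G(t,s)f)(x)=\int_{\mathbb{R}^d}f(y)\,p_{t,s}(x,dy)$ for $f\in C_b(\mathbb{R}^d)$, and by this formula $G(t,s)$ is extended to the space $B_b(\mathbb{R}^d)$ of bounded Borel functions. An evolution system of measures for $\{G(t,s)\}$ is a family $(\nu_t)_{t\in I}$ of Borel probability measures on $\mathbb{R}^d$ such that $\int_{\mathbb{R}^d}G(t,s)f\,d\nu_t=\int_{\mathbb{R}^d}f\,d\nu_s$ for every $f\in B_b(\mathbb{R}^d)$ and every $s<t$ in $I$. $\|\nabla g\|_\infty=\sup_x|\nabla g(x)|$. *)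

(* Defs.v *)
From HB Require Import structures.
From mathcomp Require Import all_boot all_order all_algebra.
From mathcomp Require Import all_classical all_reals all_analysis.

Set Implicit Arguments.
Unset Strict Implicit.
Unset Printing Implicit Defensive.

Import Order.TTheory GRing.Theory Num.Theory numFieldNormedType.Exports.

Local Open Scope classical_set_scope.
Local Open Scope ring_scope.

(* R^d is 'rV[R]_d.  The library norm `|x| on it is the sup norm, with the
   usual topology; the Euclidean norm is [enorm]. *)

Notation borelRd R d := (g_sigma_algebraType (@open 'rV[R]_d)).

Definition enorm (R : realType) (d : nat) (x : 'rV[R]_d) : R :=
  Num.sqrt (\sum_(i < d) x 0 i ^+ 2).

(* Extended-real valued, so that an unbounded function has norm +oo. *)
Definition sup_norm (R : realType) (d : nat) (h : 'rV[R]_d -> R) : \bar R :=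
  ereal_sup (range (fun x => `|h x|%:E)).

Definition grad (R : realType) (d : nat) (g : 'rV[R]_d -> R) (x : 'rV[R]_d) :
    'rV[R]_d :=
  \row_(i < d) 'D_'e_i g x.

Definition Cb (R : realType) (d : nat) (f : 'rV[R]_d -> R) : Prop :=
  continuous f /\ [bounded f x | x in setT].

Definition Bb (R : realType) (d : nat) (f : 'rV[R]_d -> R) : Prop :=
  measurable_fun (setT : set (borelRd R d)) f /\ [bounded f x | x in setT].

Definition C2 (R : realType) (d : nat) (phi : 'rV[R]_d -> R) : Prop :=
  [/\ continuous phi,
      forall i : 'I_d, (forall x, derivable phi x 'e_i) /\
        continuous (fun x => 'D_'e_i phi x)
    & forall i j : 'I_d,
        (forall x, derivable (fun y => 'D_'e_j phi y) x 'e_i) /\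
        continuous (fun x => 'D_'e_i (fun y => 'D_'e_j phi y) x)].

Definition C12 (R : realType) (d : nat) (s : R) (u : R -> 'rV[R]_d -> R) :
    Prop :=
  let O : set (R * 'rV[R]_d) := `]s, +oo[ `*` setT in
  [/\ {within O, continuous (fun z => u z.1 z.2)},
      (forall t x, s < t -> derivable (u ^~ x) t 1) /\
      {within O, continuous (fun z => derive1 (u ^~ z.2) z.1)},
      forall i : 'I_d,
        (forall t x, s < t -> derivable (u t) x 'e_i) /\
        {within O, continuous (fun z => 'D_'e_i (u z.1) z.2)}
    & forall i j : 'I_d,
        (forall t x, s < t -> derivable (fun y => 'D_'e_j (u t) y) x 'e_i) /\
        {within O, continuous
           (fun z => 'D_'e_i (fun y => 'D_'e_j (u z.1) y) z.2)}].

Definition line_or_right_halfline (R : realType) (I : set R) : Prop :=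
  I = setT \/ exists a : R, I = `[a, +oo[%classic \/ I = `]a, +oo[%classic.

Definition parabolic_dist (R : realType) (d : nat) (z w : R * 'rV[R]_d) : R :=
  enorm (z.2 - w.2) + Num.sqrt `|z.1 - w.1|.

Definition holder_loc (R : realType) (d : nat) (alpha : R) (I : set R)
    (h : R -> 'rV[R]_d -> R) : Prop :=
  forall K : set (R * 'rV[R]_d), compact K -> K `<=` I `*` setT ->
  exists L : R, forall z w, K z -> K w ->
    `|h z.1 z.2 - h w.1 w.2| <= L * parabolic_dist z w `^ alpha.

Definition elliptic_op (R : realType) (d : nat)
    (Q : R -> 'rV[R]_d -> 'M[R]_d) (b : R -> 'rV[R]_d -> 'rV[R]_d)
    (t : R) (phi : 'rV[R]_d -> R) (x : 'rV[R]_d) : R :=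
  \sum_(i < d) \sum_(j < d) Q t x i j * 'D_'e_i (fun y => 'D_'e_j phi y) x
  + \sum_(i < d) b t x 0 i * 'D_'e_i phi x.

Definition holder_coefficients (R : realType) (d : nat) (I : set R)
    (Q : R -> 'rV[R]_d -> 'M[R]_d) (b : R -> 'rV[R]_d -> 'rV[R]_d) : Prop :=
  exists alpha : R, [/\ 0 < alpha, alpha < 1,
    forall i j, holder_loc alpha I (fun t x => Q t x i j)
    & forall i, holder_loc alpha I (fun t x => b t x 0 i)].

Definition uniformly_elliptic (R : realType) (d : nat) (I : set R)
    (Q : R -> 'rV[R]_d -> 'M[R]_d) : Prop :=
  (forall t x, I t -> (Q t x)^T = Q t x) /\
  exists eta : R -> 'rV[R]_d -> R,
    (0 < ereal_inf [set (eta z.1 z.2)%:E | z in I `*` setT])%E /\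
    forall t x (xi : 'rV[R]_d), I t ->
      eta t x * enorm xi ^+ 2 <=
      \sum_(i < d) \sum_(j < d) Q t x i j * xi 0 j * xi 0 i.

Definition lyapunov_condition (R : realType) (d : nat) (I : set R)
    (Q : R -> 'rV[R]_d -> 'M[R]_d) (b : R -> 'rV[R]_d -> 'rV[R]_d) : Prop :=
  forall J : set R, is_interval J -> bounded_set J -> J `<=` I ->
  exists (phi : 'rV[R]_d -> R) (lambda : R),
    [/\ C2 phi, 0 < lambda,
        forall M : R, exists r : R, forall x, r < enorm x -> M < phi x
      & forall t x, J t -> elliptic_op Q b t phi x - lambda * phi x <= 0].

Definition bounded_classical_solution (R : realType) (d : nat)
    (Q : R -> 'rV[R]_d -> 'M[R]_d) (b : R -> 'rV[R]_d -> 'rV[R]_d)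
    (s : R) (f : 'rV[R]_d -> R) (u : R -> 'rV[R]_d -> R) : Prop :=
  let D : set (R * 'rV[R]_d) := `[s, +oo[ `*` setT in
  [/\ {within D, continuous (fun z => u z.1 z.2)},
      [bounded u z.1 z.2 | z in D],
      C12 s u,
      forall t x, s < t -> derive1 (u ^~ x) t = elliptic_op Q b t (u t) x
    & forall x, u s x = f x].

(* [G t s f x] is (G(t,s)f)(x).  On C_b it is the bounded classical solution of
   the Cauchy problem (including G(s,s)f = f); on B_b it is given by integration
   against Borel probability measures p_{t,s}(x,.).  Under the standing
   assumptions these requirements determine [G t s f] for s in I, s <= t and f
   in B_b. *)
Definition is_evolution_operator (R : realType) (d : nat) (I : set R)
    (Q : R -> 'rV[R]_d -> 'M[R]_d) (b : R -> 'rV[R]_d -> 'rV[R]_d)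
    (G : R -> R -> ('rV[R]_d -> R) -> 'rV[R]_d -> R) : Prop :=
  (forall s f, I s -> Cb f ->
     bounded_classical_solution Q b s f (fun t x => G t s f x)) /\
  exists p : R -> R -> 'rV[R]_d -> probability (borelRd R d) R,
    forall s t x f, I s -> s <= t -> Bb f ->
      G t s f x = \int[p t s x]_y f y.

Definition evolution_system_of_measures (R : realType) (d : nat) (I : set R)
    (G : R -> R -> ('rV[R]_d -> R) -> 'rV[R]_d -> R)
    (nu : R -> probability (borelRd R d) R) : Prop :=
  forall s t f, I s -> I t -> s < t -> Bb f ->
    \int[nu t]_x G t s f x = \int[nu s]_x f x.

(* mu(p) in [0, +oo]. *)
Definition moment (R : realType) (d : nat) (p : R)
    (mu : probability (borelRd R d) R) : \bar R :=
  (\int[mu]_x (enorm (x : 'rV[R]_d) `^ p)%:E)%E.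

(* Main.v *)
(* By invariance, G(t,s)f(x) - m_s(f) is the mu_t-average over y of
   G(t,s)f(x) - G(t,s)f(y).  Such a difference is at most 2 |f|_oo, and the
   gradient estimate bounds it by a constant times
   e^{omega (t-s)} (|x| + |y|) |f|_oo.  Use the second bound on the ball |y| <= r
   and the first one outside.  For t -> +oo take r = delta e^{-omega t}: by
   Chebyshev the mass outside the ball is at most
   delta^{-p} mu_t(p) e^{omega p t}, which vanishes, while the contribution of the
   ball tends to a multiple of delta.  For s -> -oo the measure mu_t is fixed and
   a fixed large r suffices. *)
Require Import Defs.
From HB Require Import structures.
From mathcomp Require Import all_boot all_order all_algebra.
From mathcomp Require Import all_classical all_reals all_analysis.
From mathcomp Require Import measurable_realfun ring.

Set Implicit Arguments.
Unset Strict Implicit.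
Unset Printing Implicit Defensive.

Import Order.TTheory GRing.Theory Num.Theory numFieldNormedType.Exports.

Local Open Scope classical_set_scope.
Local Open Scope ring_scope.

(** * Distance from a constant to an average *)

Lemma Rintegral_deviation_le (dsp : measure_display) (T : measurableType dsp)
    (R : realType) (mu : probability T R) (h : T -> R) (A : set T) (c e M : R) :
  measurable_fun setT h -> measurable A ->
  (forall y, A y -> `|c - h y| <= e) -> (forall y, `|c - h y| <= M) -> 0 <= e ->
  `|c - \int[mu]_y h y| <= e + M * fine (mu (~` A)).
Proof.
move=> mh mA hA hM e0; have mAC := measurableC mA.
have bounded_int (g : T -> R) (K : R) : measurable_fun setT g ->
    (forall y, `|g y| <= K) -> mu.-integrable setT (EFin \o g).
  move=> mg gK; apply: measurable_bounded_integrable => //.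
    exact: le_lt_trans (probability_le1 _ _) (ltry _).
  exists K; split; first exact: num_real.
  by move=> x Kx y _; exact: le_trans (gK y) (ltW Kx).
have int_c (r : R) : mu.-integrable setT (EFin \o (fun=> r) : T -> _).
  by apply: (bounded_int _ `|r|) => //; exact: measurable_cst.
have mch : measurable_fun setT (fun y => c - h y).
  by apply: measurable_funB => //; exact: measurable_cst.
have int_ch := bounded_int _ M mch hM.
have int_h : mu.-integrable setT (EFin \o h).
  apply: (bounded_int _ (`|c| + M)) => // y.
  rewrite -[h y](subKr c); apply: le_trans (ler_normB _ _) _.
  by rewrite lerD2l.
have int_1 : mu.-integrable setT (EFin \o (\1_(~` A) : T -> R)).
  exact: integrable_indic.
have int_M1 : mu.-integrable setT (EFin \o (fun y => M * \1_(~` A) y)).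
  apply: (bounded_int _ `|M|) => [|y].
    by apply: measurable_funM => //; exact: measurable_cst.
  by rewrite normrM indicE; case: (_ \in _); rewrite ?normr1 ?normr0 ?mulr1 ?mulr0.
have mu1 : fine (mu setT) = 1 by rewrite (probability_setT mu).
rewrite -{1}[c]mulr1 -mu1 -(Rintegral_cst mu measurableT) -RintegralB//.
apply: le_trans (le_normr_Rintegral _ _) _ => //.
have -> : e + M * fine (mu (~` A)) = \int[mu]_y (e + M * \1_(~` A) y).
  rewrite RintegralD// RintegralZl// Rintegral_cst// mu1 mulr1.
  by rewrite /Rintegral integral_indic// setIT.
apply: le_Rintegral => //.
- apply: (bounded_int _ M) => [|y]; first exact: measurableT_comp.
  by rewrite normr_id.
- by apply: eq_integrable (integrableD _ (int_c e) int_M1).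
- move=> y _; rewrite indicE; have [yA|nyA] := boolP (y \in A).
    rewrite in_setC yA mulr0 addr0; apply: hA; exact: set_mem.
  by rewrite in_setC nyA mulr1; apply: le_trans (hM y) _; rewrite lerDr.
Qed.

(** * Sup norm, Euclidean norm and Borel measurability *)

Lemma coord_le_mx_norm (R : realType) (d : nat) (x : 'rV[R]_d) (i : 'I_d) :
  `|x 0 i| <= `|x|.
Proof.
rewrite [leRHS]mx_normrE.
exact: (le_bigmax _ (fun ij : 'I_1 * 'I_d => `|x ij.1 ij.2|) (0, i)).
Qed.

Lemma coord_le_enorm (R : realType) (d : nat) (x : 'rV[R]_d) (i : 'I_d) :
  `|x 0 i| <= enorm x.
Proof.
rewrite /enorm -sqrtr_sqr ler_wsqrtr// (bigD1 i)//= lerDl.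
by apply: sumr_ge0 => j _; exact: sqr_ge0.
Qed.

Lemma mx_norm_le_enorm (R : realType) (d : nat) (x : 'rV[R]_d) :
  `|x| <= enorm x.
Proof.
rewrite [leLHS]mx_normrE; apply/bigmax_leP; split; first exact: sqrtr_ge0.
by move=> [i j] _ /=; rewrite ord1; exact: coord_le_enorm.
Qed.

Lemma continuous_enorm (R : realType) (d : nat) :
  continuous (@enorm R d).
Proof.
move=> x; apply: continuous_comp; last exact: sqrt_continuous.
move: x; apply: continuous_big => [|i _ x]; first exact: add_continuous.
by apply: continuousM; exact: coord_continuous.
Qed.

(** Open intervals generate the Borel sets of the line, and their preimages under [f] are open,
    hence generators of [borelRd]. *)
Lemma continuous_borelRd_measurable (R : realType) (d : nat)
    (f : 'rV[R]_d -> R) :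
  continuous f -> measurable_fun (setT : set (borelRd R d)) f.
Proof.
move=> cf; apply: (measurability _ (RGenOpens.measurableE R)).
move=> _ [_ [a [b ->] <-]]; rewrite setTI; apply: sub_sigma_algebra.
exact: (proj1 (continuousP _) cf _ (interval_open _ _)).
Qed.

(** * From bounded partial derivatives to a Lipschitz bound *)

(** Mean value theorem along the line through [z] in direction ['e_i]; a negative [h] is handled by
    exchanging the two endpoints. *)
Lemma partials_bound_step (R : realType) (d : nat) (g : 'rV[R]_d -> R) (L : R)
    (i : 'I_d) (z : 'rV[R]_d) (h : R) :
  (forall x, derivable g x 'e_i) -> (forall x, `|'D_'e_i g x| <= L) ->
  `|g (z + h *: 'e_i) - g z| <= L * `|h|.
Proof.
move=> dg gL; wlog h0 : z h / 0 <= h => [wlg|].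
  have [/wlg//|hlt] := leP 0 h.
  have := wlg (z + h *: 'e_i) (- h).
  rewrite scaleNr addrK normrN distrC; apply.
  by rewrite oppr_ge0 ltW.
pose phi (t : R) := g (z + t *: 'e_i).
(* The difference quotients of [phi] are literally those of [g] in direction ['e_i], so derivability
   transfers without a chain rule. *)
have E (t : R) : (fun k => k^-1 *: ((phi \o shift t) (k *: (1 : R)) - phi t)) =
    (fun k => k^-1 *: ((g \o shift (z + t *: 'e_i)) (k *: 'e_i) - g (z + t *: 'e_i))).
  apply/funext => k; rewrite /phi /= /shift; congr (_ *: (g _ - _)).
  by rewrite [k *: (1 : R)]mulr1 scalerDl addrCA.
have dphi (t : R) : is_derive t (1 : R) phi ('D_'e_i g (z + t *: 'e_i)).
  split; last by rewrite /derive E.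
  by rewrite /derivable E; exact: dg.
have [|c _] := @MVT_segment R phi (fun t => 'D_'e_i g (z + t *: 'e_i)) 0 h h0 (fun t _ => dphi t).
  by apply: derivable_within_continuous => t _; exact: (@ex_derive _ _ _ _ _ _ _ (dphi t)).
rewrite /phi scale0r addr0 subr0 => ->.
by rewrite normrM ler_wpM2r.
Qed.

(* Moving along one coordinate at a time needs no differentiability beyond the
   partial derivatives, at the price of a factor d. *)
Lemma partials_bound_lipschitz (R : realType) (d : nat) (g : 'rV[R]_d -> R)
    (L : R) :
  (forall (i : 'I_d) x, derivable g x 'e_i) ->
  (forall (i : 'I_d) x, `|'D_'e_i g x| <= L) -> 0 <= L ->
  forall x y, `|g x - g y| <= d%:R * L * `|x - y|.
Proof.
move=> dg gL L0 x y.
have step (s : seq 'I_d) (v z : 'rV[R]_d) :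
    `|g (z + \sum_(i <- s) v 0 i *: 'e_i) - g z| <= (size s)%:R * L * `|v|.
  elim: s z => [|i s IH] z; first by rewrite big_nil addr0 subrr normr0 !mul0r.
  rewrite big_cons addrA -(subrKA (g (z + v 0 i *: 'e_i))).
  apply: le_trans (ler_normD _ _) _.
  rewrite /= -natr1 2!mulrDl mul1r lerD//.
  apply: le_trans (partials_bound_step _ _ (dg i) (gL i)) _.
  by rewrite ler_wpM2l// coord_le_mx_norm.
have := step (enum 'I_d) (x - y) y.
by rewrite big_enum -row_sum_delta subrKC -cardE card_ord.
Qed.

(** * Mass outside large balls *)

Lemma cball_measurable (R : realType) (d : nat) (r : R) :
  measurable ([set y : 'rV[R]_d | `|y| <= r] : set (borelRd R d)).
Proof.
rewrite -[X in measurable X]setTI.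
have mnorm : measurable_fun (setT : set (borelRd R d)) (fun y : 'rV[R]_d => `|y|).
  by apply: continuous_borelRd_measurable => y; exact: norm_continuous.
exact: (mnorm measurableT _ (measurable_itv `]-oo, r])).
Qed.

(** Chebyshev's inequality. The ball is a sup-norm ball while the moment is Euclidean; this is
    harmless because [r < |y|] forces [r < enorm y]. *)
Lemma moment_tail_le (R : realType) (d : nat) (p : R)
    (mu : probability (borelRd R d) R) (r : R) :
  0 <= r -> 0 <= p ->
  ((r `^ p)%:E * mu (~` [set y : 'rV[R]_d | (`|y| <= r)%R]) <= moment p mu)%E.
Proof.
move=> r0 p0; set B := ~` _.
have mB : measurable (B : set (borelRd R d)) by apply: measurableC; exact: cball_measurable.
have mm : measurable_fun setT
    (fun y : borelRd R d => (enorm (y : 'rV[R]_d) `^ p)%:E).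
  apply/measurable_EFinP.
  apply: (@measurableT_comp _ _ _ _ _ _ (fun z : R => z `^ p)
    _ (@enorm R d : borelRd R d -> R)); first exact: measurable_powR.
  by apply: continuous_borelRd_measurable; exact: (@continuous_enorm R d).
rewrite -integral_cst//.
apply: (@le_trans _ _ (\int[mu]_(y in B) (enorm (y : 'rV[R]_d) `^ p)%:E)%E).
  apply: ge0_le_integral => //.
  - by move=> y _; rewrite lee_fin powR_ge0.
  - exact: measurable_funTS.
  - move=> y; rewrite /B /= => /negP; rewrite -ltNge => ry.
    rewrite lee_fin ge0_ler_powR// ?nnegrE ?sqrtr_ge0//.
    exact: le_trans (ltW ry) (mx_norm_le_enorm _).
apply: ge0_subset_integral => //.
by move=> y _; rewrite lee_fin powR_ge0.
Qed.

(** The complements of the balls of integer radius decrease to the empty set, so continuity from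
    above sends their mass to 0. *)
Lemma borelRd_tight (R : realType) (d : nat)
    (mu : probability (borelRd R d) R) (e : R) : 0 < e ->
  exists2 r : R, 0 <= r & fine (mu (~` [set y : 'rV[R]_d | `|y| <= r])) < e.
Proof.
move=> e0.
pose F (n : nat) : set (borelRd R d) := ~` [set y : 'rV[R]_d | `|y| <= n%:R].
have mF n : measurable (F n) by apply: measurableC; exact: cball_measurable.
have F0 : \bigcap_n F n = set0.
  apply/seteqP; split => // y /(_ (Num.truncn `|y : 'rV[R]_d|).+1 I) [].
  exact/ltW/truncnS_gt.
have : mu \o F @ \oo --> mu (\bigcap_n F n).
  apply: nonincreasing_cvg_mu => //.
  - exact: le_lt_trans (probability_le1 _ _) (ltry _).
  - by rewrite F0.
  - move=> m n mn; apply/subsetPset => y; rewrite /F /= => yn ym; apply: yn.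
    by apply: le_trans ym _; rewrite ler_nat.
rewrite F0 measure0 => /fine_cvgP [_] /cvgrPdist_lt /(_ _ e0) [n _ /(_ n (leqnn n))].
rewrite /= sub0r normrN => /(le_lt_trans (ler_norm _)) H.
by exists n%:R.
Qed.

(** * Auxiliary facts on limits, thresholds and bounded functions *)

Lemma uniform_cvg_dist (R : realType) (U : choiceType) (T : Type)
    (F : set_system T) (FF : Filter F) (A : set U) (h : T -> U -> R)
    (l : U -> R) :
  (forall e, 0 < e ->
     \forall t \near F, forall x, A x -> `|l x - h t x| < e) ->
  {uniform A, h @ F --> l}.
Proof.
move=> hl P /uniform_nbhs [E [entE EP]].
move: entE; rewrite -entourage_ballE => -[e /= e0 eE].
near=> t; apply: EP => x Ax.
apply: eE => /=; rewrite -ball_normE /=.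
by move: x Ax; near: t; exact: hl.
Unshelve. all: by end_near. Qed.

(** Behind every choice of a small constant below: the [+ 1] keeps the denominator positive even
    when [a = 0]. *)
Lemma mul_div_succ_lt (R : realType) (a e : R) :
  0 <= a -> 0 < e -> a * (e / (a + 1)) < e.
Proof.
move=> a0 e0; have a1 : 0 < a + 1 by rewrite ltr_wpDl.
by rewrite mulrCA gtr_pMr// ltr_pdivrMr// mul1r ltrDl.
Qed.

Lemma expR_ltW_ln (R : realType) (omega z u : R) :
  omega < 0 -> 0 < z -> ln z / omega < u -> expR (omega * u) < z.
Proof.
move=> w0 z0; rewrite ltr_ndivrMr// => H.
by rewrite -[ltRHS]lnK ?posrE// ltr_expR mulrC.
Qed.

Lemma right_halfline_up (R : realType) (I : set R) (s t : R) :
  line_or_right_halfline I -> I s -> s <= t -> I t.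
Proof.
case=> [->//|[a [->|->]]] /=; rewrite !in_itv /= !andbT => h st.
  exact: le_trans h st.
exact: lt_le_trans h st.
Qed.

Lemma Cb_Bb (R : realType) (d : nat) (f : 'rV[R]_d -> R) : Cb f -> Bb f.
Proof. by case=> cf bf; split=> //; exact: continuous_borelRd_measurable. Qed.

Lemma Cb_bound (R : realType) (d : nat) (f : 'rV[R]_d -> R) :
  Cb f -> exists2 M : R, 0 <= M & forall x, `|f x| <= M.
Proof.
case=> _ [M0 [_ h]]; exists (`|M0| + 1) => [|x]; first by rewrite addr_ge0.
by apply: (h _ _ x) => //; rewrite ltr_pwDr// ler_norm.
Qed.

(** * Estimates for the evolution operator *)

Section evolution.
Context (R : realType) (d : nat) (I : set R)
  (Q : R -> 'rV[R]_d -> 'M[R]_d) (b : R -> 'rV[R]_d -> 'rV[R]_d)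
  (G : R -> R -> ('rV[R]_d -> R) -> 'rV[R]_d -> R)
  (mu : R -> probability (borelRd R d) R).
Context (HG : is_evolution_operator I Q b G).

Lemma evolution_contractive (s t M : R) (f : 'rV[R]_d -> R) :
  I s -> s <= t -> Cb f -> (forall x, `|f x| <= M) ->
  forall x, `|G t s f x| <= M.
Proof.
move=> Is st Cf fM x; have [_ [p Gp]] := HG.
rewrite (Gp _ _ _ _ Is st (Cb_Bb Cf)).
have M0 : 0 <= M := le_trans (normr_ge0 _) (fM x).
(* With [c = 0] and [A] the whole space, the term for the complement vanishes and the bound [M]
   remains. *)
have := @Rintegral_deviation_le _ _ _ (p t s x) f setT 0 M M.
rewrite setCT measure0 mulr0 addr0 sub0r normrN; apply => //.
- exact: (Cb_Bb Cf).1.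
- by move=> y _; rewrite sub0r normrN.
- by move=> y; rewrite sub0r normrN.
Qed.

(** For [t > s] the spatial partial derivatives exist since the solution is of class [C12]; each is
    at most the Euclidean length of the gradient, hence at most [L * M]. *)
Lemma evolution_lipschitz (s t L M : R) (f : 'rV[R]_d -> R) :
  I s -> s < t -> Cb f -> (forall x, `|f x| <= M) -> 0 <= M -> 0 <= L ->
  (sup_norm (fun x => enorm (grad (G t s f) x)) <= L%:E * sup_norm f)%E ->
  forall x y, `|G t s f x - G t s f y| <= d%:R * (L * M) * `|x - y|.
Proof.
move=> Is st Cf fM M0 L0 Hsup.
have [_ _ [_ _ C1 _] _ _] := HG.1 _ _ Is Cf.
apply: partials_bound_lipschitz => [i x|i x|]; last exact: mulr_ge0.
  exact: (C1 i).1.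
rewrite -lee_fin EFinM.
apply: (@le_trans _ _ (L%:E * sup_norm f)%E); last first.
  apply: lee_wpmul2l; first by rewrite lee_fin.
  by apply: ge_ereal_sup => _ [y _ <-]; rewrite lee_fin.
apply: (le_trans _ Hsup); apply: (@le_trans _ _ (enorm (grad (G t s f) x))%:E).
  by rewrite lee_fin; have := coord_le_enorm (grad (G t s f) x) i; rewrite mxE.
by apply: ereal_sup_ubound; exists x => //=; rewrite ger0_norm ?sqrtr_ge0.
Qed.

Context (Hmu : evolution_system_of_measures I G mu).

Lemma evolution_deviation (s t L M k r : R) (f : 'rV[R]_d -> R) :
  I s -> I t -> s < t -> Cb f -> (forall x, `|f x| <= M) -> 0 <= M ->
  0 <= L -> 0 <= r ->
  (sup_norm (fun x => enorm (grad (G t s f) x)) <= L%:E * sup_norm f)%E ->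
  forall x, `|x| <= k ->
  `|G t s f x - \int[mu s]_y f y| <=
  d%:R * (L * M) * (k + r)
  + 2 * M * fine (mu t (~` [set y : 'rV[R]_d | `|y| <= r])).
Proof.
move=> Is It st Cf fM M0 L0 r0 Hsup x xk.
have lip := evolution_lipschitz Is st Cf fM M0 L0 Hsup.
have GM := evolution_contractive Is (ltW st) Cf fM.
have A0 : 0 <= d%:R * (L * M) by rewrite !mulr_ge0.
(* The Lipschitz bound makes [G t s f] continuous, hence Borel, as needed to integrate it against
   [mu t]. *)
have cG : continuous (G t s f).
  move=> y.
  apply: (proj2 (@cvgrPdist_lt _ _ _ (nbhs y) _ (G t s f) (G t s f y))) => e e0.
  near=> z; apply: le_lt_trans (lip _ _) _.
  apply: (@le_lt_trans _ _ (d%:R * (L * M) * (e / (d%:R * (L * M) + 1)))).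
    rewrite ler_wpM2l// ltW//; near: z.
    by apply: cvgr_dist_lt => //; rewrite divr_gt0// ltr_wpDl.
  exact: mul_div_succ_lt.
(* Invariance turns the [mu s]-average of [f] into the [mu t]-average of [G t s f], which is then
   split over the ball of radius [r]. *)
rewrite -(Hmu Is It st (Cb_Bb Cf)).
apply: Rintegral_deviation_le.
- exact: continuous_borelRd_measurable.
- exact: cball_measurable.
- move=> y /= yr; apply: le_trans (lip _ _) _; rewrite ler_wpM2l//.
  exact: le_trans (ler_normB _ _) (lerD xk yr).
- move=> y; apply: le_trans (ler_normB _ _) _.
  by rewrite mulr_natl mulr2n lerD.
- by rewrite mulr_ge0// addr_ge0// (le_trans _ xk).
Unshelve. all: by end_near. Qed.

End evolution.

(** * Both limits, uniformly on compact sets *)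

Theorem theorem5p6 (R : realType) (d : nat) (I : set R)
    (Q : R -> 'rV[R]_d -> 'M[R]_d) (b : R -> 'rV[R]_d -> 'rV[R]_d)
    (G : R -> R -> ('rV[R]_d -> R) -> 'rV[R]_d -> R)
    (mu : R -> probability (borelRd R d) R)
    (omega C p : R)
    (d_ge1 : (1 <= d)%N)
    (I_halfline : line_or_right_halfline I)
    (Hholder : holder_coefficients I Q b)
    (Hell : uniformly_elliptic I Q)
    (Hlyap : lyapunov_condition I Q b)
    (HG : is_evolution_operator I Q b G)
    (omega_lt0 : omega < 0) (C_gt0 : 0 < C)
    (Hgrad : forall s t f, I s -> s + 1 <= t -> Cb f ->
       (sup_norm (fun x => enorm (grad (G t s f) x)) <=
        (C * expR (omega * (t - s)))%:E * sup_norm f)%E)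
    (Hmu : evolution_system_of_measures I G mu)
    (p_gt0 : 0 < p)
    (Hmoment : (moment p (mu t) * (expR (omega * p * t))%:E)%E
       @[t --> +oo] --> 0%E) :
  (forall s f, I s -> Cb f ->
     (forall x, G t s f x @[t --> +oo] --> \int[mu s]_y f y) /\
     (forall K : set 'rV[R]_d, compact K ->
        {uniform K, G t s f @[t --> +oo] --> (fun=> \int[mu s]_y f y)})) /\
  (I = setT -> forall t f, Cb f ->
     (forall x, (G t s f x - \int[mu s]_y f y) @[s --> -oo] --> 0) /\
     (forall K : set 'rV[R]_d, compact K ->
        {uniform K, (fun x => G t s f x - \int[mu s]_y f y) @[s --> -oo]
           --> (fun=> 0)})).
Proof.
(* Singletons are compact, so pointwise limits follow from the locally uniform ones. *)
have pointwise (F : set_system ('rV[R]_d -> R)) (l : 'rV[R]_d -> R) : Filter F ->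
    (forall K : set 'rV[R]_d, compact K -> {uniform K, F --> l}) ->
    forall x, g x @[g --> F] --> l x.
  by move=> FF Fl x; rewrite -(uniform_set1 l x FF); apply: Fl; exact: compact_set1.
have norm_bound (K : set 'rV[R]_d) : compact K ->
    exists2 k : R, 0 <= k & forall x, K x -> `|x| <= k.
  move=> /compact_bounded [k0 [_ h]]; exists (`|k0| + 1); first by rewrite addr_ge0.
  by move=> x Kx; apply: (h _ _ x Kx); rewrite ltr_pwDr// ler_norm.
have deviation s t f M k r : I s -> s + 1 <= t -> Cb f ->
    (forall x, `|f x| <= M) -> 0 <= M -> 0 <= r -> forall x, `|x| <= k ->
    `|G t s f x - \int[mu s]_y f y| <=
    d%:R * C * M * (k + r) * expR (omega * (t - s))
    + 2 * M * fine (mu t (~` [set y : 'rV[R]_d | `|y| <= r])).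
  move=> Is st Cf fM M0 r0 x xk.
  have slt : s < t by apply: lt_le_trans st; rewrite ltrDl.
  have It := right_halfline_up I_halfline Is (ltW slt).
  have L0 : 0 <= C * expR (omega * (t - s)) by rewrite mulr_ge0 ?expR_ge0// ltW.
  apply: le_trans
    (evolution_deviation HG Hmu Is It slt Cf fM M0 L0 r0 (Hgrad _ _ _ Is st Cf) xk) _.
  rewrite lerD2r le_eqVlt; apply/orP; left; apply/eqP; ring.
have D0 M k : 0 <= M -> 0 <= k -> 0 <= d%:R * C * M * k.
  by move=> M0 k0; rewrite !mulr_ge0// ltW.
have forward s f : I s -> Cb f -> forall K : set 'rV[R]_d, compact K ->
    {uniform K, G t s f @[t --> +oo] --> (fun=> \int[mu s]_y f y)}.
  move=> Is Cf K /norm_bound [k k0 Kk]; have [M M0 fM] := Cb_bound Cf.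
  apply: uniform_cvg_dist => e e0.
  (* One third of [e] each for the distance [k] of [x], the radius [r] of the ball, and the mass
     outside it; [z], [delta] and [m] are the respective tolerances. *)
  have e3 : 0 < e / 3 by rewrite divr_gt0.
  have A0 : 0 <= d%:R * C * M * expR (- (omega * s)) by apply: D0 => //; exact: expR_ge0.
  pose delta := e / 3 / (d%:R * C * M * expR (- (omega * s)) + 1).
  have delta0 : 0 < delta by rewrite divr_gt0// ltr_wpDl.
  have dp0 : 0 < delta `^ p by rewrite powR_gt0.
  pose z := e / 3 / (d%:R * C * M * k + 1).
  have z0 : 0 < z by rewrite divr_gt0// ltr_wpDl// D0.
  pose m := e / 3 / (2 * M + 1).
  have m0 : 0 < m by rewrite divr_gt0// ltr_wpDl// mulr_ge0.
  have /fine_cvgP [mfin /cvgrPdist_lt /(_ _ (mulr_gt0 dp0 m0)) msmall] := Hmoment.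
  near=> t => x Kx; rewrite distrC.
  have st : s + 1 <= t by near: t; apply: nbhs_pinfty_ge; exact: num_real.
  (* The radius grows just fast enough that its product with [expR (omega * (t - s))] is the
     constant [delta * expR (- (omega * s))]. *)
  pose r := delta * expR (- (omega * t)).
  have r0 : 0 < r by rewrite mulr_gt0 ?expR_gt0.
  apply: le_lt_trans (deviation _ _ _ M k r Is st Cf fM M0 (ltW r0) x (Kk x Kx)) _.
  have -> : e = (e / 3 + e / 3) + e / 3 by field.
  have -> : d%:R * C * M * (k + r) * expR (omega * (t - s)) =
      d%:R * C * M * k * expR (omega * (t - s)) +
      d%:R * C * M * expR (- (omega * s)) * delta.
    have -> : expR (- (omega * s)) = expR (omega * (t - s)) * expR (- (omega * t)).
      by rewrite -expRD; congr expR; ring.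
    rewrite /r; ring.
  apply: ltrD; first apply: ltrD.
  - apply: le_lt_trans (mul_div_succ_lt (D0 _ _ M0 k0) e3).
    apply: ler_wpM2l; first exact: D0.
    apply/ltW/expR_ltW_ln => //; rewrite ltrBrDr.
    by near: t; apply: nbhs_pinfty_gt; exact: num_real.
  - exact: mul_div_succ_lt.
  - have M20 : 0 <= 2 * M by rewrite mulr_ge0.
    apply: le_lt_trans (mul_div_succ_lt M20 e3).
    apply: ler_wpM2l => //.
    set B := ~` _.
    have muB : mu t B \is a fin_num.
      apply: fin_num_measure; apply: measurableC; exact: cball_measurable.
    (* After multiplication by [delta]^ p[, the tail mass can be compared with the decaying moment,
       which is eventually below]delta [^ p * m]. *)
    rewrite -(ler_pM2l dp0).
    have msm : fine (moment p (mu t) * (expR (omega * p * t))%:E)%E < delta `^ p * m.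
      apply: le_lt_trans (ler_norm _) _; rewrite -normrN -sub0r.
      by near: t; exact: msmall.
    apply: le_trans (ltW msm).
    rewrite -lee_fin fineK; last by near: t; exact: mfin.
    rewrite EFinM fineK//.
    (* This identity splits [delta]^ p[into the Chebyshev weight]r [^ p] and the decay factor of the
       moment hypothesis. *)
    have -> : delta `^ p = r `^ p * expR (omega * p * t).
      rewrite /r (powRM _ (ltW delta0) (expR_ge0 _)) -expRM -mulrA -expRD.
      have -> : - (omega * t) * p + omega * p * t = 0 by ring.
      by rewrite expR0 mulr1.
    rewrite EFinM muleAC lee_wpmul2r ?lee_fin ?expR_ge0//.
    by apply: moment_tail_le; exact: ltW.
split=> [s f Is Cf|IT t f Cf].
  split; last exact: forward.
  exact: (pointwise (G t s f @[t --> +oo]) _ _ (forward s f Is Cf)).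
have backward (K : set 'rV[R]_d) : compact K ->
    {uniform K, (fun x => G t s f x - \int[mu s]_y f y) @[s --> -oo]
       --> (fun=> 0)}.
  move=> /norm_bound [k k0 Kk]; have [M M0 fM] := Cb_bound Cf.
  apply: uniform_cvg_dist => e e0.
  have e2 : 0 < e / 2 by rewrite divr_gt0.
  have M20 : 0 <= 2 * M by rewrite mulr_ge0.
  (* Since [t] is fixed, [r] depends on [mu t] only and is chosen before [s]; tightness replaces the
     moment hypothesis. *)
  have [|r r0 tail] := borelRd_tight (mu t) (e := e / 2 / (2 * M + 1)).
    by rewrite divr_gt0// ltr_wpDl.
  pose z := e / 2 / (d%:R * C * M * (k + r) + 1).
  have kr0 : 0 <= k + r by rewrite addr_ge0.
  have z0 : 0 < z by rewrite divr_gt0// ltr_wpDl// D0.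
  near=> s => x Kx; rewrite sub0r normrN.
  have Is : I s by rewrite IT.
  have st : s + 1 <= t.
    rewrite -lerBrDr; near: s; apply: nbhs_ninfty_le; exact: num_real.
  apply: le_lt_trans (deviation _ _ _ M k r Is st Cf fM M0 r0 x (Kk x Kx)) _.
  rewrite [ltRHS]splitr; apply: ltrD.
  - apply: le_lt_trans (mul_div_succ_lt (D0 _ _ M0 kr0) e2).
    apply: ler_wpM2l; first exact: D0.
    (* The exponential falls below [z] once [s < t - ln z / omega]. *)
    apply/ltW/expR_ltW_ln => //; rewrite ltrBrDr addrC -ltrBrDr.
    by near: s; apply: nbhs_ninfty_lt; exact: num_real.
  - apply: le_lt_trans (mul_div_succ_lt M20 e2).
    by rewrite ler_wpM2l// ltW.
split; last exact: backward.
exact: (pointwise ((fun x => G t s f x - \int[mu s]_y f y) @[s --> -oo])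
  (fun=> 0) _ backward).
Unshelve. all: by end_near. Qed.
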